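(* Let $\Bbbk$ be a field and let $G\subseteq\mathrm{GL}_n(\Bbbk)$ be a finite subgroup, acting linearly on $\Bbbk[x_1,\dots,x_n]$. Then the subalgebra of invariants $A=\Bbbk[x_1,\dots,x_n]^G$ is saturated in $\Bbbk[x_1,\dots,x_n]$ if and only if $G$ admits no non-trivial homomorphisms $G\to\Bbbk^{\times}$.
   Context: A polynomial $h\in\Bbbk[x_1,\dots,x_n]\setminus\Bbbk$ is closed if $\Bbbk[h]$ is integrally closed in $\Bbbk[x_1,\dots,x_n]$. For $f\in\Bbbk[x_1,\dots,x_n]\setminus\Bbbk$, a generative polynomial of $f$ is a closed polynomial $h$ such that $f=F(h)$ for some $F\in\Bbbk[t]$; it exists and is unique up to affine transformations $h\mapsto c_1h+c_2$ ($c_1\in\Bbbk^{\times}$, $c_2\in\Bbbk$). A subalgebra $A\subseteq\Bbbk[x_1,\dots,x_n]$ is saturated if for every $f\in A\setminus\Bbbk$ the generative polynomial of $f$ is contained in $A$ (since $\Bbbk\subseteq A$, this does not depend on the choice of generative polynomial). *)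

(* Defs.v *)
From HB Require Import structures.
From mathcomp Require Import all_boot all_order all_algebra finmap mpoly.

Set Implicit Arguments.
Unset Strict Implicit.
Unset Printing Implicit Defensive.

Import GRing.Theory.

Local Open Scope ring_scope.
Local Open Scope fset_scope.

Section ClosedPolynomials.

Context {k : fieldType} {n : nat}.
Implicit Types (f h : {mpoly k[n]}) (F : {poly k}).

Definition constant_mpoly f : Prop := exists c : k, f = c%:MP.

(* [horner_alg h] is the morphism F |-> F(h) from k[t] to k[x_1, ..., x_n],
   so its image is k[h] and [integralOver (horner_alg h) u] says that u is
   a root of a monic polynomial with coefficients in k[h]. *)
Definition closed_mpoly h : Prop :=
  ~ constant_mpoly h /\
  forall u : {mpoly k[n]},
    integralOver (horner_alg h) u -> exists F, u = horner_alg h F.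

Definition generative_mpoly f h : Prop :=
  closed_mpoly h /\ exists F, f = horner_alg h F.

(* Generative polynomials exist and are unique up to h |-> c1 h + c2, and A
   contains the constants, so quantifying over all of them is harmless. *)
Definition saturated (A : subalgClosed {mpoly k[n]}) : Prop :=
  forall f, f \in A -> ~ constant_mpoly f ->
  forall h, generative_mpoly f h -> h \in A.

End ClosedPolynomials.

Section LinearGroups.

Context {k : fieldType} {n : nat}.
Implicit Types (G : {fset 'M[k]_n}) (g : 'M[k]_n).

Definition finite_subgroup_GL G : Prop :=
  [/\ {in G, forall g, g \in unitmx},
      1%:M \in G,
      {in G &, forall g1 g2, g1 *m g2 \in G} &
      {in G, forall g, invmx g \in G}].

(* The left action on polynomial functions on column vectors:
   (g f)(v) = f(g^-1 v). *)
Definition mpoly_act g (f : {mpoly k[n]}) : {mpoly k[n]} :=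
  f \mPo [tuple \sum_(j < n) invmx g i j *: 'X_j | i < n].

Definition invariants G : {pred {mpoly k[n]}} :=
  fun f => [forall g : G, mpoly_act (val g) f == f].

Lemma invariants_subalg_closed G : subalg_closed (invariants G).
Proof.
rewrite /invariants /mpoly_act; split => [|a u v|u v].
- by apply/forallP => g; rewrite comp_mpoly1.
- move=> /forallP hu /forallP hv; apply/forallP => g.
  by rewrite linearP /= (eqP (hu g)) (eqP (hv g)).
- move=> /forallP hu /forallP hv; apply/forallP => g.
  by rewrite rmorphM /= (eqP (hu g)) (eqP (hv g)).
Qed.

HB.instance Definition _ G :=
  GRing.isSubalgClosed.Build k {mpoly k[n]} (invariants G)
    (GRing.subalg_closed_semi (invariants_subalg_closed G)).

(* Homomorphisms G -> k^*; the values of chi off G are irrelevant. *)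
Definition linear_character G (chi : 'M[k]_n -> k) : Prop :=
  {in G, forall g, chi g != 0} /\
  {in G &, {morph chi : g1 g2 / g1 *m g2 >-> g1 * g2}}.

Definition trivial_character G (chi : 'M[k]_n -> k) : Prop :=
  {in G, forall g, chi g = 1}.

End LinearGroups.

(* Main.v *)
From HB Require Import structures.
Require Import Defs.
From mathcomp Require Import all_boot all_order all_algebra finmap mpoly zify.

Set Implicit Arguments.
Unset Strict Implicit.
Unset Printing Implicit Defensive.

Import Order.TTheory GRing.Theory.

Local Open Scope ring_scope.

(** If G has no non-trivial character and f = F(h) is invariant with h closed,
    then each g h takes the value f under F, hence is integral over k[h] and
    lies in k[h].  As the same holds for g^-1, the map g acts on k[h] by an
    affine substitution h |-> c h + c0 ([group_acts_affinely]).  The scalar c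
    is a character of G, so c = 1; since g fixes the origin, c0 = 0.

    Conversely let chi be a non-trivial character.  It is enough to find a
    closed h with g h = chi(g) h for all g: the orbit product of h is an
    invariant of the form c h^|G|, so saturation would make h invariant
    ([saturated_semiinvariant]).  Closedness is tested on leading monomials for
    the graded order, after an arbitrary morphism Phi of polynomial algebras:
    if the exponent vector of the leading monomial of Phi(h) is primitive, then
    h is closed ([closed_of_primitive_lead]).  Indeed, an element u integral
    over k[h] has Phi(u) with leading exponents parallel to those of Phi(h),
    hence an integral multiple of them, and subtracting c h^q from u lowers the
    leading monomial.

    To produce such an h in at least two variables, let x be the smallest
    variable for the order and pi = x - phi, where phi is a sum of powers of the
    other variables, so chosen that only the identity of GL_n maps pi to an
    element of k pi + k.  The shear Phi : x |-> x + phi sends pi to x, so for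
    g <> 1 the leading monomial of Phi(g pi) is strictly larger than that of
    Phi(pi).  Put N = prod_g g pi and

      q = sum_g chi(g)^-1 (N / g pi),

    which is the twisted orbit sum of p = N / pi.  The summand g = 1 divides N
    by the factor with the smallest leading monomial, so it alone determines the
    leading monomial of Phi(q), and q is a non-zero semi-invariant of weight
    chi.  Multiplying q by powers of N and of another invariant, the orbit
    product of a variable, makes the leading exponents primitive
    ([closed_semiinvariant_of_leads]).  In one variable, G consists of scalars
    and the variable itself serves as h. *)

(** * Leading monomials and algebraic dependence *)

Section LeadingMonomials.

Context {k : fieldType} {n : nat}.
Implicit Types (f h H w : {mpoly k[n]}) (a : {poly k}) (M : 'X_{1..n}).

Lemma mlead_sum_dominant (I : finType) (F : I -> {mpoly k[n]}) i0 :
  (forall i, i != i0 -> F i != 0 -> (mlead (F i) < mlead (F i0))%O) ->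
  mlead (\sum_i F i) = mlead (F i0) /\ mleadc (\sum_i F i) = mleadc (F i0).
Proof.
move=> dom.
have coef0 : (\sum_i F i)@_(mlead (F i0)) = mleadc (F i0).
  rewrite (bigD1 i0) //= mcoeffD raddf_sum /= big1 ?addr0 // => i ne.
  have [->|nz] := eqVneq (F i) 0; first by rewrite mcoeff0.
  exact/mcoeff_gt_mlead/dom.
suff eqM : mlead (\sum_i F i) = mlead (F i0) by rewrite eqM.
have [z0|nz0] := eqVneq (F i0) 0.
  congr mlead; rewrite (bigD1 i0) //= big1 ?addr0 // => i ne.
  apply/eqP/negPn/negP => /(dom i ne).
  by rewrite z0 mlead0 ltx0.
apply/le_anti/andP; split; last first.
  by apply: msupp_le_mlead; rewrite mcoeff_msupp coef0 mleadc_eq0.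
apply: le_trans (mlead_sum_le _ _ _) _; apply/joinsP => i _.
have [->//|ne] := eqVneq i i0.
have [->|nz] := eqVneq (F i) 0; first by rewrite mlead0 le0x.
exact/ltW/dom.
Qed.

Lemma sum_neq0_distinct_leads (I : finType) (F : I -> {mpoly k[n]}) :
  (forall i j, F i != 0 -> F j != 0 -> mlead (F i) = mlead (F j) -> i = j) ->
  (exists i, F i != 0) -> \sum_i F i != 0.
Proof.
move=> inj [i1 nz1].
case: (@arg_maxP _ _ I i1 (fun i => F i != 0) (fun i => mlead (F i)) nz1) => i0 nz0 max.
have [|_ lc] := @mlead_sum_dominant I F i0.
  move=> i ne nz; have le_i := max i nz; rewrite lt_neqAle [X in _ && X]le_i andbT.
  by apply: contraNneq ne => /(inj _ _ nz nz0) ->.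
by rewrite -mleadc_eq0 lc mleadc_eq0.
Qed.

Lemma horner_algE f a : horner_alg f a = \sum_(i < size a) a`_i *: f ^+ i.
Proof.
rewrite {1}/horner_alg /horner_morph horner_coef size_map_poly.
by apply: eq_bigr => i _; rewrite coef_map /= mulr_algl.
Qed.

(** The powers of H have leading monomials of strictly increasing degree, so
    only the top coefficient of a matters. *)
Lemma horner_alg_lead H a : mlead H != 0%MM -> a != 0 ->
  horner_alg H a != 0 /\ mlead (horner_alg H a) = (mlead H *+ (size a).-1)%MM.
Proof.
move=> ncH nza.
have nzH : H != 0 by apply: contraNneq ncH => ->; rewrite mlead0.
have sa : (0 < size a)%N by rewrite size_poly_gt0.
have lt_i0 : ((size a).-1 < size a)%N by rewrite prednK.
pose i0 := Ordinal lt_i0.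
have leadE (i : 'I_(size a)) : a`_i != 0 ->
    mlead (a`_i *: H ^+ i) = (mlead H *+ i)%MM.
  by move=> nz; rewrite mleadZ // mleadX.
have nzi0 : a`_i0 != 0 by rewrite /= -lead_coefE lead_coef_eq0.
have [|eqM lc] := @mlead_sum_dominant _ (fun i : 'I_(size a) => a`_i *: H ^+ i) i0.
  move=> i ne nz; have nzi : a`_i != 0.
    by apply: contraNneq nz => ->; rewrite scale0r.
  rewrite !leadE //; apply: lt_mdeg_ltmc; rewrite !mdegMn ltn_pmul2l.
    rewrite ltn_neqAle -ltnS prednK // ltn_ord andbT.
    by apply: contraNneq ne => /val_inj ->.
  by rewrite lt0n mdeg_eq0.
rewrite horner_algE; split; last by rewrite eqM leadE.
by rewrite -mleadc_eq0 lc mleadc_eq0 scaler_eq0 negb_or nzi0 expf_neq0.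
Qed.

Lemma horner_alg_inj H : mlead H != 0%MM -> injective (horner_alg H).
Proof.
move=> ncH a b /eqP; rewrite -subr_eq0 -rmorphB => ab0.
apply/eqP; rewrite -subr_eq0; apply: contraTT ab0 => nz.
by have [] := horner_alg_lead ncH nz.
Qed.

Lemma nonconstant_mlead h : ~ constant_mpoly h <-> mlead h != 0%MM.
Proof.
split=> [nc|nz [c E]]; last by rewrite E mleadC eqxx in nz.
apply/eqP => h0; apply: nc; exists h@_0%MM; apply/mpolyP => m.
rewrite mcoeffC; have [<-|nm] := eqVneq 0%MM m; first by rewrite mulr1.
by rewrite mulr0; apply: mcoeff_gt_mlead; rewrite h0 lt0x eq_sym.
Qed.

(** Otherwise the terms a_i(H) w^i would have pairwise distinct leading
    monomials, and could not cancel. *)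
Lemma algebraic_leads_parallel H w (P : {poly {poly k}}) :
  mlead H != 0%MM -> w != 0 -> P != 0 ->
  root (map_poly (horner_alg H) P) w ->
  exists m l, (0 < m)%N /\ (mlead w *+ m = mlead H *+ l)%MM.
Proof.
move=> ncH nzw nzP /rootP Pw0.
have sumE : \sum_(i < size P) horner_alg H P`_i * w ^+ i = 0.
  rewrite -[RHS]Pw0 (@horner_coef_wide _ (size P)) ?size_poly //.
  by apply: eq_bigr => i _; rewrite coef_map.
pose F (i : 'I_(size P)) := horner_alg H P`_i * w ^+ i.
pose par := [exists ij : 'I_(size P) * 'I_(size P),
  [&& ij.1 != ij.2, F ij.1 != 0, F ij.2 != 0 & mlead (F ij.1) == mlead (F ij.2)]].
have nzF i : F i != 0 -> P`_i != 0.
  by apply: contraNneq => Pi0; rewrite /F Pi0 rmorph0 mul0r.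
have leadF i : F i != 0 -> mlead (F i) = (mlead H *+ (size P`_i).-1 + mlead w *+ i)%MM.
  move=> /nzF /(horner_alg_lead ncH) [nz E].
  by rewrite mleadM ?expf_neq0 // E mleadX.
have: par; last case/existsP=> -[i j] /and4P[/= ne nzi nzj /eqP eqij].
  apply: contraT => npar.
  suff: \sum_i F i != 0 by rewrite sumE eqxx.
  apply: sum_neq0_distinct_leads => [i j nzi nzj eqij|].
    apply/eqP/negPn/negP => ne; case/negP: npar; apply/existsP; exists (i, j).
    by apply/and4P; split=> //; apply/eqP.
  have sP : (0 < size P)%N by rewrite size_poly_gt0.
  have lt_i0 : ((size P).-1 < size P)%N by rewrite prednK.
  exists (Ordinal lt_i0); rewrite mulf_neq0 ?expf_neq0 //=.
  rewrite -lead_coefE; apply: (horner_alg_lead ncH _).1.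
  by rewrite lead_coef_eq0.
rewrite !leadF // in eqij.
wlog lt_ij : i j ne nzi nzj eqij / (i < j)%N.
  move=> wl; case: (ltngtP i j) => [lt|lt|/val_inj E]; last by rewrite E eqxx in ne.
    exact: (wl i j).
  by apply: (wl j i) => //; rewrite eq_sym.
exists (j - i)%N, ((size (P`_i)%R).-1 - (size (P`_j)%R).-1)%N; split.
  by rewrite subn_gt0.
apply/mnmP => t; rewrite !mulmnE.
have := congr1 (fun m : 'X_{1..n} => m t) eqij; rewrite !mnmDE !mulmnE.
move: (mlead w t) (mlead H t) => x y E.
have := congr1 (subn^~ (y * (size (P`_j)%R).-1 + x * i)%N) E.
by rewrite subnDr subnDl !mulnBr.
Qed.

End LeadingMonomials.

(** * A criterion for closedness *)

Section ClosednessCriterion.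

Context {k : fieldType} {n N : nat} (Phi : {lrmorphism {mpoly k[n]} -> {mpoly k[N]}}).
Implicit Types (h u : {mpoly k[n]}).

Lemma lrmorph_horner_alg h a : Phi (horner_alg h a) = horner_alg (Phi h) a.
Proof.
rewrite !horner_algE linear_sum; apply: eq_bigr => i _ /=.
by rewrite linearZ /= rmorphXn.
Qed.

(** If u <> 0, a relation over k[h] can be divided by powers of u until its
    constant coefficient c(h) is non-zero; applying Phi then gives
    c(Phi h) = 0, although Phi h is transcendental. *)
Lemma algebraic_eq0 h u (P : {poly {poly k}}) :
  mlead (Phi h) != 0%MM -> P != 0 -> root (map_poly (horner_alg h) P) u ->
  Phi u = 0 -> u = 0.
Proof.
move=> nch + + Phiu0; elim/poly_ind: P => [|P c IHP]; first by rewrite eqxx.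
rewrite rmorphD rmorphM /= map_polyX map_polyC /= => nz.
rewrite rootE !hornerE => /eqP Pu0.
have /eqP : Phi (horner_alg h c) = 0.
  by have := congr1 Phi Pu0; rewrite rmorphD rmorphM /= Phiu0 mulr0 add0r rmorph0.
rewrite lrmorph_horner_alg -(rmorph0 (horner_alg (Phi h))).
rewrite (inj_eq (horner_alg_inj nch)) => /eqP c0.
move: nz Pu0; rewrite c0 polyC0 addr0 rmorph0 addr0 => nz /eqP.
rewrite mulf_eq0 => /orP[Pu0|/eqP //].
by apply: IHP Pu0; apply: contraNneq nz => ->; rewrite mul0r.
Qed.

(** The coordinates of M have no common factor, expressed through the Gauss
    lemma, which is how this is applied; M = 0 is excluded. *)
Definition primitive_mnm (M : 'X_{1..N}) :=
  forall m l, (forall i, m %| l * M i)%N -> (m %| l)%N.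

(** The leading exponents m of Phi u satisfy d m = l M with d > 0, so that
    m = q M by primitivity, and u - c h^q has a smaller leading monomial for
    a suitable c in k.  Well-founded induction on m concludes; it ends by
    [algebraic_eq0] when Phi kills the difference. *)
Lemma closed_of_primitive_lead h :
  primitive_mnm (mlead (Phi h)) -> closed_mpoly h.
Proof.
set M := mlead (Phi h) => prim.
have ncM : M != 0%MM.
  apply/eqP => M0; suff: (0 %| 1)%N by [].
  by apply: prim => i; rewrite M0 mnm0E muln0.
split=> [[c E]|u].
  by case/eqP: ncM; rewrite /M E -[c%:MP]mulr1 mul_mpolyC linearZ rmorph1 /=
     -mul_mpolyC mulr1 mleadC.
move E : (mlead (Phi u)) => m.
elim/(well_founded_ind (@ltom_wf N)): m u E => m IH u Em intu.
have [P monP Pu] := intu; have nzP := monic_neq0 monP.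
have [/(algebraic_eq0 ncM nzP Pu) ->|nzu] := eqVneq (Phi u) 0.
  by exists 0; rewrite rmorph0.
have [|d [l [d_gt0 Edl]]] := algebraic_leads_parallel ncM nzu nzP.
  have := rmorph_root Phi Pu; rewrite -map_poly_comp.
  by congr (is_true (root _ _)); apply: eq_map_poly => a /=; rewrite lrmorph_horner_alg.
have /dvdnP[q El] : (d %| l)%N.
  apply: prim => i; apply/dvdnP; exists (m i).
  have := congr1 (fun m : 'X_{1..N} => m i) Edl.
  by rewrite !mulmnE Em => ->; rewrite mulnC.
have {Edl} Emq : m = (M *+ q)%MM.
  apply/mnmP => i; have := congr1 (fun m : 'X_{1..N} => m i) Edl.
  rewrite !mulmnE Em El mulnA => /eqP; rewrite eqn_pmul2r // => /eqP ->.
  by [].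
pose c := mleadc (Phi u) / mleadc (Phi h) ^+ q.
pose F := c *: 'X^q : {poly k}.
have nzlh : mleadc (Phi h) != 0.
  by rewrite mleadc_eq0; apply: contraNneq ncM; rewrite /M => ->; rewrite mlead0.
have FE : horner_alg h F = c *: h ^+ q.
  by rewrite linearZ /= rmorphXn /= horner_algX mulr_algl.
have nzc : c != 0 by rewrite mulf_neq0 ?mleadc_eq0 ?invr_eq0 ?expf_neq0.
have PhiF : Phi (horner_alg h F) = c *: Phi h ^+ q.
  by rewrite FE linearZ /= rmorphXn.
have mF : mlead (Phi (horner_alg h F)) = m.
  by rewrite PhiF mleadZ // mleadX -?mleadc_eq0 // Emq.
have intu' : integralOver (horner_alg h) (u - horner_alg h F).
  by apply: integral_sub => //; apply: integral_id.
suff [G EG] : exists G, u - horner_alg h F = horner_alg h G.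
  by exists (G + F); rewrite rmorphD /= -EG subrK.
have [z|nzu'] := eqVneq (Phi (u - horner_alg h F)) 0.
  have [Q monQ Qu] := intu'; exists 0; rewrite rmorph0.
  exact: algebraic_eq0 ncM (monic_neq0 monQ) Qu z.
apply: (IH (mlead (Phi (u - horner_alg h F)))) => //.
rewrite lt_neqAle; apply/andP; split.
  rewrite -mleadc_eq0 in nzu'; apply: contraNneq nzu' => ->.
  rewrite rmorphB /= mcoeffB PhiF mcoeffZ Emq mleadcX /c divfK ?expf_neq0 //.
  by rewrite -Emq -Em subrr.
rewrite rmorphB /=; apply: le_trans (mleadB_le _ _) _.
by rewrite mF Em joinxx.
Qed.

End ClosednessCriterion.

(** * The linear action and its invariants *)

Section LinearAction.

Context {k : fieldType} {n : nat}.
Implicit Types (g : 'M[k]_n) (f h : {mpoly k[n]}).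

Definition linear_subst g : n.-tuple {mpoly k[n]} :=
  [tuple \sum_(j < n) invmx g i j *: 'X_j | i < n].

HB.instance Definition _ g :=
  GRing.LRMorphism.copy (mpoly_act g) (comp_mpoly (linear_subst g)).

Lemma mpoly_actX g i : mpoly_act g 'X_i = \sum_(j < n) invmx g i j *: 'X_j.
Proof. by rewrite /mpoly_act comp_mpolyXU -tnth_nth tnth_mktuple. Qed.

Lemma mpoly_actC g c : mpoly_act g c%:MP = c%:MP.
Proof. exact: comp_mpolyC. Qed.

Lemma lrmorphism_mpoly_ext N (Phi Psi : {lrmorphism {mpoly k[n]} -> {mpoly k[N]}}) :
  (forall i, Phi 'X_i = Psi 'X_i) -> Phi =1 Psi.
Proof.
move=> eqX f; rewrite (mpolyE f) !linear_sum; apply: eq_bigr => m _ /=.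
rewrite !linearZ /= mpolyXE_id !rmorph_prod; congr (_ *: _).
by apply: eq_bigr => i _; rewrite !rmorphXn /= eqX.
Qed.

Lemma mpoly_act1 : mpoly_act (1%:M : 'M[k]_n) =1 id.
Proof.
move=> f; apply: (@lrmorphism_mpoly_ext n (mpoly_act 1%:M) idfun) => i.
rewrite [LHS]mpoly_actX invmx1 (bigD1 i) //= mxE eqxx scale1r big1 ?addr0 // => j ne.
by rewrite mxE eq_sym (negPf ne) scale0r.
Qed.

Lemma mpoly_actM g1 g2 f : g1 \in unitmx -> g2 \in unitmx ->
  mpoly_act (g1 *m g2) f = mpoly_act g1 (mpoly_act g2 f).
Proof.
move=> u1 u2.
have invM : invmx (g1 *m g2) = invmx g2 *m invmx g1.
  have u12 : g1 *m g2 \in unitmx by rewrite unitmx_mul u1.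
  rewrite -[RHS](mulmxK u12) mulmxA -(mulmxA (invmx g2)) mulVmx // mulmx1.
  by rewrite mulVmx // mul1mx.
apply: (@lrmorphism_mpoly_ext n (mpoly_act (g1 *m g2))
          (mpoly_act g1 \o mpoly_act g2)) => i.
rewrite [LHS]mpoly_actX [RHS]/= mpoly_actX linear_sum /= invM.
under eq_bigr => j _ do rewrite mxE scaler_suml.
rewrite exchange_big /=; apply: eq_bigr => j _.
rewrite linearZ /= mpoly_actX scaler_sumr.
by apply: eq_bigr => l _; rewrite scalerA.
Qed.

Lemma mpoly_actK g : g \in unitmx ->
  cancel (mpoly_act g) (mpoly_act (invmx g)).
Proof.
move=> u f; rewrite -mpoly_actM ?unitmx_inv // mulVmx //.
exact: mpoly_act1.
Qed.

Lemma mpoly_act_eval0 g f :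
  (mpoly_act g f).@[fun=> 0] = f.@[fun=> 0].
Proof.
rewrite comp_mpoly_meval; apply: meval_eq => i.
rewrite tnth_mktuple raddf_sum big1 // => j _ /=.
by rewrite mevalZ mevalXU mulr0.
Qed.

End LinearAction.

Section FiniteGroup.

Context {k : fieldType} {n : nat} (G : {fset 'M[k]_n}).
Hypothesis gG : finite_subgroup_GL G.

Lemma group_unit : {in G, forall g, g \in unitmx}.
Proof. by case: gG. Qed.

Lemma group_reindex (R : Type) (idx : R) (op : Monoid.com_law idx) g0
    (F : 'M[k]_n -> R) : g0 \in G ->
  \big[op/idx]_(g : G) F (g0 *m val g) = \big[op/idx]_(g : G) F (val g).
Proof.
move=> g0G; have [uG _ mG _] := gG.
pose tr (g : G) : G := [` mG _ _ g0G (valP g)]%fset.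
have tr_inj : injective tr.
  move=> g1 g2 /(congr1 val) /= /(congr1 (mulmx (invmx g0))).
  by rewrite !mulKmx ?uG // => /val_inj.
by rewrite [RHS](reindex_inj tr_inj).
Qed.

Lemma invariantsP f :
  reflect {in G, forall g, mpoly_act g f = f} (f \in invariants G).
Proof.
apply: (iffP forallP) => [fixf g gG'|fixf g]; last exact/eqP/fixf/valP.
exact/eqP/(fixf [` gG']%fset).
Qed.

Lemma orbit_prod_invariant f :
  \prod_(g : G) mpoly_act (val g) f \in invariants G.
Proof.
apply/invariantsP => g0 g0G; rewrite rmorph_prod /=.
under eq_bigr => g _ do rewrite -mpoly_actM ?group_unit ?(valP g) //.
exact: (@group_reindex _ _ _ g0 (fun g => mpoly_act g f)).
Qed.

(** The orbit product of [h] is an invariant of the form c h^|G|, so [h] is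
    one of its generative polynomials. *)
Lemma saturated_semiinvariant h (psi : 'M[k]_n -> k) :
  saturated (invariants G) -> closed_mpoly h ->
  {in G, forall g, mpoly_act g h = psi g *: h} -> h \in invariants G.
Proof.
move=> satA clh semih; have [nch _] := clh.
have [uG oneG _ _] := gG.
have nzM := (nonconstant_mlead h).1 nch.
have nzh : h != 0 by apply: contraNneq nzM => ->; rewrite mlead0.
have nzpsi g : g \in G -> psi g != 0.
  move=> gG'; apply: contraNneq nzh => psi0.
  by rewrite -(mpoly_actK (uG g gG') h) semih // psi0 scale0r rmorph0.
pose c := \prod_(g : G) psi (val g).
have nzc : c != 0 by apply/prodf_neq0 => g _; exact/nzpsi/valP.
have fE : \prod_(g : G) mpoly_act (val g) h = c *: h ^+ #|{: G}|.
  under eq_bigr => g _ do rewrite semih ?(valP g) //.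
  by rewrite scaler_prod prodr_const.
apply: (satA (c *: h ^+ #|{: G}|)); first by rewrite -fE orbit_prod_invariant.
  apply/nonconstant_mlead; rewrite mleadZ // mleadX //.
  rewrite -mdeg_eq0 mdegMn muln_eq0 mdeg_eq0 (negPf nzM) -lt0n.
  by apply/card_gt0P; exists [` oneG]%fset.
split=> //; exists (c *: 'X^#|{: G}|).
by rewrite linearZ /= rmorphXn /= horner_algX mulr_algl.
Qed.

End FiniteGroup.

(** * Groups without characters have saturated invariants *)

Section TrivialCharactersSaturated.

Context {k : fieldType} {n : nat} (G : {fset 'M[k]_n}).
Hypothesis gG : finite_subgroup_GL G.

Lemma horner_alg_comp (h : {mpoly k[n]}) (P Q : {poly k}) :
  horner_alg h (Q \Po P) = horner_alg (horner_alg h P) Q.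
Proof.
rewrite comp_polyE linear_sum horner_algE; apply: eq_bigr => i _ /=.
by rewrite -mul_polyC rmorphM rmorphXn /= horner_algC mulr_algl.
Qed.

(** u is a root of F(T) - F(h), a polynomial in T whose leading coefficient
    is a non-zero constant. *)
Lemma integral_of_same_value (h u : {mpoly k[n]}) (F : {poly k}) :
  (1 < size F)%N -> horner_alg u F = horner_alg h F ->
  integralOver (horner_alg h) u.
Proof.
move=> sF FE; pose P := map_poly polyC F - F%:P.
have szF : size (map_poly (@polyC k) F) = size F.
  exact/size_map_inj_poly/polyC0/polyC_inj.
have lcP : lead_coef P = (lead_coef F)%:P.
  rewrite /P lead_coefDl ?lead_coef_map_inj ?polyC0 //; first exact: polyC_inj.
  by rewrite szF size_polyN; apply: leq_ltn_trans (size_polyC_leq1 _) sF.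
have nzF : lead_coef F != 0 by rewrite lead_coef_eq0 -size_poly_gt0 ltnW.
exists (((lead_coef F)^-1)%:P *: P).
  by rewrite monicE lead_coefZ lcP -polyCM mulVf.
rewrite rootE map_polyZ hornerZ /P rmorphB /= map_polyC /= -map_poly_comp.
rewrite !hornerE -FE; suff -> : (map_poly (horner_alg h \o polyC) F).[u] = horner_alg u F.
  by rewrite subrr mulr0.
congr (_.[_]); apply: eq_map_poly => c /=.
by rewrite horner_algC.
Qed.

(** Both g h and g^-1 h lie in k[h], say g h = P(h) and g^-1 h = Q(h); then
    Q(P(h)) = h, so that P has degree one. *)
Lemma group_acts_affinely h F :
  closed_mpoly h -> horner_alg h F \in invariants G -> (1 < size F)%N ->
  {in G, forall g, exists c c0, mpoly_act g h = c *: h + c0%:MP}.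
Proof.
move=> [nch clh] /(invariantsP) invF sF.
have nzM := (nonconstant_mlead h).1 nch.
have [uG _ _ vG] := gG.
have inkh g : g \in G -> exists P, mpoly_act g h = horner_alg h P.
  move=> gG'; apply/clh/(integral_of_same_value sF).
  by rewrite -[RHS](invF g gG') lrmorph_horner_alg.
move=> g gG'; have [P EP] := inkh g gG'; have [Q EQ] := inkh _ (vG g gG').
(* g (g^-1 h) = h reads Q(P(h)) = h, and h is transcendental. *)
have QP : Q \Po P = 'X.
  apply: (horner_alg_inj nzM); rewrite horner_alg_comp horner_algX -EP.
  have := lrmorph_horner_alg (mpoly_act g) h Q; rewrite /= -EQ => <-.
  rewrite -mpoly_actM ?unitmx_inv ?uG //.
  by rewrite mulmxV ?uG // mpoly_act1.
have sP : size P = 2%N.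
  have := size_comp_poly Q P; rewrite QP size_polyX => /esym/eqP.
  rewrite /= muln_eq1 => /andP[_ /eqP].
  by case: (size P) => // m /= ->.
exists P`_1, P`_0; rewrite EP horner_algE sP !big_ord_recl big_ord0 /=.
by rewrite expr0 expr1 addr0 addrC -[_ *: 1]mul_mpolyC mulr1.
Qed.

(** The scalar c in g h = c h + c0 is read off from the leading monomial of h,
    which is not constant; this gives the character without any choice. *)
Lemma saturated_of_trivial_characters :
  ~ (exists chi : 'M[k]_n -> k,
        linear_character G chi /\ ~ trivial_character G chi) ->
  saturated (invariants G).
Proof.
move=> notriv f fA ncf h [clh [F fE]]; have [nch _] := clh.
have nzM := (nonconstant_mlead h).1 nch.
have nzh : h != 0 by apply: contraNneq nzM => ->; rewrite mlead0.
have sF : (1 < size F)%N.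
  rewrite ltnNge; apply/negP => /size1_polyC Fc; apply: ncf.
  by exists F`_0; rewrite fE Fc horner_algC coefC eqxx -mul_mpolyC mulr1.
have affG : {in G, forall g, exists c c0, mpoly_act g h = c *: h + c0%:MP}.
  by apply: (@group_acts_affinely h F); rewrite // -fE.
pose chi g := (mpoly_act g h)@_(mlead h) / mleadc h.
have chiE g c c0 : mpoly_act g h = c *: h + c0%:MP -> chi g = c.
  move=> E; rewrite /chi E mcoeffD mcoeffZ mcoeffC (negPf nzM) mulr0 addr0.
  by rewrite mulfK // mleadc_eq0.
have [uG _ mG vG] := gG.
have chi_lin : linear_character G chi.
  have chiM : {in G &, {morph chi : g1 g2 / g1 *m g2 >-> g1 * g2}}.
    move=> g1 g2 G1 G2; have [c1 [d1 E1]] := affG _ G1; have [c2 [d2 E2]] := affG _ G2.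
    rewrite (chiE _ _ _ E1) (chiE _ _ _ E2).
    apply: (chiE _ _ (c2 * d1 + d2)).
    rewrite mpoly_actM ?uG // E2 raddfD /= linearZ /= E1 mpoly_actC.
    rewrite scalerDr scalerA -addrA mulrC; congr (_ + _).
    by rewrite mpolyCD mpolyCM mul_mpolyC.
  split=> // g gG'; apply/eqP => z.
  have := chiM _ _ gG' (vG _ gG'); rewrite z mul0r mulmxV ?uG //.
  rewrite (chiE _ 1 0) ?mpoly_act1 ?scale1r ?addr0 // => /eqP.
  by rewrite oner_eq0.
apply/invariantsP => g gG'; have [c [c0 E]] := affG g gG'.
have c1 : c = 1.
  apply/eqP/negPn/negP => ne1; apply: notriv; exists chi; split=> // triv.
  by case/eqP: ne1; rewrite -(triv g gG') (chiE _ _ _ E).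
have := mpoly_act_eval0 g h; rewrite E c1 scale1r mevalD mevalC => h0.
by rewrite (_ : c0 = 0) ?mpolyC0 ?addr0 //; apply: (addrI h.@[fun=> 0]); rewrite h0 addr0.
Qed.

End TrivialCharactersSaturated.

(** * Semi-invariants and primitive exponent vectors *)

(** Take s + 1 = 2 v: the first number is then d = 2 v (a + 1) - 1, prime to
    v, and the second one is v (r + 2 b), where r is chosen so that
    r + 2 b = 1 + 2 b d. *)
Lemma exists_coprime_combination a b v : (0 < v)%N ->
  exists r s, coprime (s * a.+1 + a) (r * v + s * b + b).
Proof.
move=> v_gt0; pose d := ((v.*2.-1) * a.+1 + a)%N.
have dE : d.+1 = (v.*2 * a.+1)%N.
  by rewrite /d -addnS -mulSnr prednK ?double_gt0 //.
have d_gt0 : (0 < d)%N.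
  by rewrite -ltnS dE; case: v v_gt0 {d dE} => // v _; rewrite doubleS mulnS.
exists (1 + b.*2 * d.-1)%N, (v.*2.-1); rewrite -/d -addnA -mulSnr prednK ?double_gt0 //.
have -> : ((1 + b.*2 * d.-1) * v + v.*2 * b = v * (1 + b.*2 * d))%N.
  rewrite -[in RHS](prednK d_gt0) mulnS -!muln2 !mulnDr !mulnDl mulnC; lia.
rewrite coprimeMr; apply/andP; split.
  have: coprime d d.+1 by rewrite coprimenS.
  by rewrite dE -muln2 -!mulnA coprimeMr => /andP[].
by rewrite /coprime [(1 + _)%N]addnC gcdnMDl gcdn1.
Qed.

Lemma primitive_of_coprime N (M : 'X_{1..N}) i j :
  coprime (M i) (M j) -> primitive_mnm M.
Proof.
move=> co m l dvd; have: (m %| gcdn (l * M i) (l * M j))%N by rewrite dvdn_gcd !dvd.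
by rewrite -muln_gcdr (eqP co) muln1.
Qed.

Section Characters.

Context {k : fieldType} {n : nat} (G : {fset 'M[k]_n}) (chi : 'M[k]_n -> k).
Hypotheses (gG : finite_subgroup_GL G) (lin_chi : linear_character G chi).

Lemma character1 : chi 1%:M = 1.
Proof.
have [_ oneG _ _] := gG; have [nz chiM] := lin_chi.
have /eqP := chiM _ _ oneG oneG; rewrite mulmx1 -{1}[chi 1%:M]mulr1.
by rewrite (inj_eq (mulfI (nz _ oneG))) => /eqP <-.
Qed.

Definition twisted_orbit_sum (p : {mpoly k[n]}) :=
  \sum_(g : G) (chi (val g))^-1 *: mpoly_act (val g) p.

Lemma twisted_orbit_sum_semiinvariant p :
  {in G, forall g, mpoly_act g (twisted_orbit_sum p) = chi g *: twisted_orbit_sum p}.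
Proof.
move=> g0 g0G; have [nz chiM] := lin_chi.
rewrite /twisted_orbit_sum linear_sum /= scaler_sumr.
rewrite -(@group_reindex _ _ _ gG _ _ _ g0
  (fun g => chi g0 *: ((chi g)^-1 *: mpoly_act g p))) //=.
apply: eq_bigr => g _; rewrite linearZ /= -mpoly_actM ?(group_unit gG) ?(valP g) //.
by rewrite chiM ?(valP g) // scalerA invfM mulrA mulfV ?mul1r // nz.
Qed.

End Characters.

(** * A polynomial moved by every non-trivial matrix *)

Section ShearedPolynomial.

Context {k : fieldType} {m : nat}.
Notation n := m.+2.
Notation s := (ord_max : 'I_n).
Implicit Types (g : 'M[k]_n) (l : 'I_n -> {mpoly k[n]}).

(** Two consecutive exponents for each variable, all of them distinct and
    at least 2: from g x^e = al x^e and g x^(e+1) = al x^(e+1) one gets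
    g x = x, whereas a single exponent would only give g x up to a scalar. *)
Definition power_sum l : {mpoly k[n]} :=
  \sum_(j < n | j != s) (l j ^+ j.*2.+2 + l j ^+ j.*2.+3).

Definition sheared l : {mpoly k[n]} := l s - power_sum l.

Local Notation X := (fun i : 'I_n => 'X_i : {mpoly k[n]}).
Local Notation phi := (power_sum X).
Local Notation pi := (sheared X).

(** The parameter c makes the inverse of a shear another shear. *)
Definition shear (c : k) : {mpoly k[n]} -> {mpoly k[n]} :=
  comp_mpoly [tuple if i == s then 'X_s + c *: phi else 'X_i | i < n].

HB.instance Definition _ c :=
  GRing.LRMorphism.copy (shear c)
    (comp_mpoly [tuple if i == s then 'X_s + c *: phi else 'X_i | i < n]).

Lemma shearX c i : shear c 'X_i = if i == s then 'X_s + c *: phi else 'X_i.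
Proof. by rewrite /shear comp_mpolyXU -tnth_nth tnth_mktuple. Qed.

Lemma lrmorph_power_sum (Psi : {lrmorphism {mpoly k[n]} -> {mpoly k[n]}}) l :
  Psi (power_sum l) = power_sum (Psi \o l).
Proof.
by rewrite rmorph_sum; apply: eq_bigr => j _; rewrite /= rmorphD !rmorphXn.
Qed.

Lemma shear_phi c : shear c phi = phi.
Proof.
rewrite lrmorph_power_sum; apply: eq_bigr => j /negPf ne /=.
by rewrite shearX ne.
Qed.

Lemma shearK c : cancel (shear c) (shear (- c)).
Proof.
move=> f; apply: (@lrmorphism_mpoly_ext _ _ _ (shear (- c) \o shear c) idfun) => i /=.
rewrite shearX; case: eqP => [->|/eqP/negPf ne]; last by rewrite shearX ne.
by rewrite raddfD /= linearZ /= shear_phi shearX eqxx scaleNr subrK.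
Qed.

Lemma shear_pi : shear 1 pi = 'X_s.
Proof. by rewrite raddfB /= shear_phi shearX eqxx scale1r addrK. Qed.

Lemma unshearX : shear (-1) 'X_s = pi.
Proof. by rewrite shearX eqxx scaleN1r. Qed.

Section Components.

Variable l : 'I_n -> {mpoly k[n]}.
Hypothesis hom_l : forall i, l i \is 1.-homog.

Lemma pihomog_form_power (d e : nat) i :
  pihomog mdeg d (l i ^+ e) = if e == d then l i ^+ e else 0.
Proof.
have hom : l i ^+ e \is e.-homog by rewrite -[e in e.-homog]mul1n; apply: dhomogMn.
have [<-|ne] := eqVneq e d; first exact: pihomog_dE.
exact: pihomog_ne0 hom.
Qed.

Lemma pihomog1_sheared : pihomog mdeg 1 (sheared l) = l s.
Proof.
rewrite /sheared raddfB /= pihomog_dE //; apply/eqP; rewrite subr_eq addrC -subr_eq subrr.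
rewrite eq_sym /power_sum raddf_sum big1 // => j _ /=.
by rewrite raddfD /= !pihomog_form_power addr0.
Qed.

Lemma pihomog_power_sum j (b : bool) : j != s ->
  pihomog mdeg (b + j.*2.+2) (power_sum l) = l j ^+ (b + j.*2.+2).
Proof.
move=> nej; rewrite raddf_sum (bigD1 j) //= big1 => [|i /andP[_ ne]].
  rewrite raddfD /= !pihomog_form_power addr0.
  case: b; rewrite /= ?add1n ?add0n eqxx.
    by rewrite ltn_eqF // add0r.
  by rewrite gtn_eqF // addr0.
have {ne nej} ne : (i != j :> nat) by [].
rewrite raddfD /= !pihomog_form_power.
by rewrite !ifF ?addr0 //; apply/eqP; case: b; lia.
Qed.

Lemma pihomog_sheared j (b : bool) : j != s ->
  pihomog mdeg (b + j.*2.+2) (sheared l) = - l j ^+ (b + j.*2.+2).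
Proof.
move=> nej; rewrite raddfB /= pihomog_power_sum // -[l s]expr1 pihomog_form_power.
by case: b; rewrite ?sub0r.
Qed.

End Components.

Lemma homogX i : X i \is 1.-homog.
Proof. by rewrite dhomogX /= mdeg1. Qed.

Lemma mpoly_act_sheared g : mpoly_act g pi = sheared (mpoly_act g \o X).
Proof. by rewrite raddfB /= lrmorph_power_sum. Qed.

Lemma homog_actX g i : (mpoly_act g \o X) i \is 1.-homog.
Proof.
by rewrite /= mpoly_actX; apply: rpred_sum => j _; apply/rpredZ/homogX.
Qed.

(** Compare homogeneous components: those of pi are its individual terms. *)
Lemma pi_trivial_stabilizer g (al be : k) : g \in unitmx ->
  mpoly_act g pi = al *: pi + be%:MP -> g = 1%:M.
Proof.
move=> ug E; pose L := mpoly_act g \o X.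
have homL i : L i \is 1.-homog := homog_actX g i.
have comp d : (0 < d)%N -> pihomog mdeg d (sheared L) = al *: pihomog mdeg d pi.
  move=> d0; rewrite -mpoly_act_sheared E raddfD /= linearZ /=.
  rewrite (@pihomog_ne0 _ _ _ 0 d be%:MP) ?addr0 //.
    by case: d d0.
  by rewrite -[be%:MP]mulr1 mul_mpolyC; apply/rpredZ/dhomog1.
have Es : L s = al *: 'X_s.
  by rewrite -(pihomog1_sheared homL) comp // pihomog1_sheared //; exact: homogX.
have Ej (b : bool) j : j != s -> L j ^+ (b + j.*2.+2) = al *: 'X_j ^+ (b + j.*2.+2).
  move=> ne; apply: oppr_inj; rewrite -(pihomog_sheared homL) // comp; last by rewrite addnS.
  by rewrite pihomog_sheared ?scalerN //; exact: homogX.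
have nzX i : X i != 0 by rewrite -msupp_eq0 msuppX.
have nzL i : L i != 0.
  apply: contraNneq (nzX i) => /(congr1 (mpoly_act (invmx g))).
  by rewrite /L /= mpoly_actK // rmorph0 => ->.
have nzal : al != 0.
  by apply: contraNneq (nzL s) => z; rewrite Es z scale0r.
(* Divide the relation in degree e + 1 by the one in degree e. *)
have LX j : j != s -> L j = 'X_j.
  move=> ne; have := Ej true j ne; rewrite add1n exprS (Ej false j ne) add0n.
  rewrite [in RHS]exprS -scalerAr; apply: contra_eq => neLX.
  rewrite (inj_eq (scalerI nzal)); apply: contra neLX => /eqP /mulIf -> //.
  by rewrite expf_neq0.
have ne0s : (ord0 : 'I_n) != s by [].
have al1 : al = 1.
  have := Ej false ord0 ne0s; rewrite LX // -{1}['X_ord0 ^+ _]scale1r => /eqP.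
  rewrite -subr_eq0 -scalerBl scaler_eq0 expf_eq0 (negPf (nzX _)) andbF orbF subr_eq0.
  by move/eqP.
have LXall i : L i = 'X_i.
  by have [->|/LX //] := eqVneq i s; rewrite Es al1 scale1r.
suff iE : invmx g = 1%:M by rewrite -[g]invmxK iE invmx1.
apply/matrixP => i j; have := congr1 (mcoeff U_(j)) (LXall i).
rewrite /L /= mpoly_actX raddf_sum /= mcoeffXU mxE => <-.
rewrite (bigD1 j) //= big1 => [|j' ne]; last first.
  by rewrite mcoeffZ mcoeffXU (negPf ne) mulr0.
by rewrite mcoeffZ mcoeffXU eqxx mulr1 addr0.
Qed.

End ShearedPolynomial.

(** * Leading monomials after the shear *)

Section LeadsAfterShear.

Context {k : fieldType} {m : nat}.
Notation n := m.+2.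
Notation s := (ord_max : 'I_n).
Implicit Types (g : 'M[k]_n) (f : {mpoly k[n]}).

Local Notation X := (fun i : 'I_n => 'X_i : {mpoly k[n]}).
Local Notation phi := (power_sum X).
Local Notation pi := (sheared X).

(** The last variable is the smallest one of the graded order. *)
Lemma le_last_var (M : 'X_{1..n}) : (M <= U_(s)%MM)%O -> M = 0%MM \/ M = U_(s)%MM.
Proof.
move=> leM; have := lemc_mdeg leM; rewrite mdeg1 leq_eqVlt ltnS leqn0 mdeg_eq0.
case/orP=> [/mdeg1P[i /eqP Mi]|/eqP]; [right|by left].
have [<-//|ne] := eqVneq i s; rewrite Mi in leM *.
have lt_is : (i < s)%N by rewrite ltn_neqAle ne /= -ltnS.
move: leM; rewrite leNgt => /negP[]; apply/ltmcP; first by rewrite !mdeg1.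
exists i => [j lt_ji|]; rewrite !mnm1E.
  by rewrite -!val_eqE /= !gtn_eqF //; apply: ltn_trans lt_is.
by rewrite eqxx -val_eqE /= gtn_eqF.
Qed.

Lemma msupp_phi_last (M : 'X_{1..n}) : M \in msupp phi -> M s = 0%N.
Proof.
rewrite mcoeff_msupp raddf_sum => nz; apply/eqP; apply: contraNT nz => Ms.
rewrite big1 // => j ne /=; rewrite mcoeffD !mcoeffXn.
have nM e : ((U_(j) *+ e)%MM == M) = false.
  apply: contraNF Ms => /eqP <-.
  by rewrite mulmnE mnm1E (negPf ne).
by rewrite !nM addr0.
Qed.

(** Only the component of degree 2 of phi is needed, to bound its degree from
    below. *)
Lemma mlead_phi : (1 < mdeg (mlead phi))%N /\ mlead phi s = 0%N.
Proof.
have hom : pihomog mdeg 2 phi = 'X_ord0 ^+ 2.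
  exact: (@pihomog_power_sum _ _ _ homogX ord0 false).
have [M Mphi dM] : exists2 M, M \in msupp phi & mdeg M = 2%N.
  have /negP nz : ('X_ord0 ^+ 2 : {mpoly k[n]}) != 0.
    by rewrite expf_neq0 // -msupp_eq0 msuppX.
  case: (boolP (has (fun M => mdeg M == 2%N) (msupp phi))) => [/hasP[M Mphi /eqP dM]|].
    by exists M.
  move=> /hasPn none; case: nz; rewrite -hom pihomogE big_seq_cond big_pred0 // => M.
  by apply/negP => /andP[/none /negP].
split; first by rewrite -dM; apply/lemc_mdeg/msupp_le_mlead.
by apply/msupp_phi_last/mlead_supp; apply: contraTneq Mphi => ->; rewrite msupp0.
Qed.

(** Shearing a linear form f adds a multiple of phi; if this multiple is zero
    then f does not involve the last variable, and otherwise phi, which has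
    larger degree and does not involve it either, takes the lead. *)
Lemma mlead_shear_linear (c : 'I_n -> k) f : f = \sum_i c i *: 'X_i -> f != 0 ->
  mlead (shear 1 f) != 0%MM /\ mlead (shear 1 f) s = 0%N.
Proof.
move=> fE nzf.
have suppf M : M \in msupp f -> exists2 i, c i != 0 & M = U_(i)%MM.
  rewrite mcoeff_msupp fE raddf_sum /= => nz.
  have /existsP[i nzi] : [exists i, (c i *: 'X_i : {mpoly k[n]})@_M != 0].
    apply: contraNT nz => /existsPn all0; rewrite big1 // => i _.
    by apply/eqP; rewrite -[_ == _]negbK all0.
  move: nzi; rewrite mcoeffZ mcoeffX.
  have [<-|_] := eqVneq U_(i)%MM M; last by rewrite mulr0 eqxx.
  by rewrite mulr1; exists i.
have shE : shear 1 f = f + c s *: phi.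
  rewrite {1}fE linear_sum /= (bigD1 s) //= linearZ /= shearX eqxx scale1r scalerDr.
  rewrite fE [in RHS](bigD1 s) //= addrAC; congr (_ + _ + _).
  by apply: eq_bigr => i /negPf ne; rewrite linearZ /= shearX ne.
have [deg_phi phi_s] := mlead_phi.
have [cs0|nzcs] := eqVneq (c s) 0.
  rewrite shE cs0 scale0r addr0.
  have [i nzi ->] := suppf _ (mlead_supp nzf).
  rewrite -mdeg_eq0 mdeg1 mnm1E; split=> //.
  by have [Ei|//] := eqVneq i s; rewrite Ei cs0 eqxx in nzi.
have -> : mlead (shear 1 f) = mlead phi.
  rewrite shE mleadDr mleadZ //; apply: lt_mdeg_ltmc.
  by have [i _ ->] := suppf _ (mlead_supp nzf); rewrite mdeg1.
by split=> //; rewrite -mdeg_eq0 -lt0n ltnW.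
Qed.

(** Otherwise the sheared polynomial would be al x + be, with x the last
    variable; undoing the shear gives g pi = al pi + be. *)
Lemma mlead_shear_act_pi g : g \in unitmx -> g != 1%:M ->
  (U_(s)%MM < mlead (shear 1 (mpoly_act g pi)))%O.
Proof.
move=> ug; apply: contraNT; rewrite -leNgt => le_s.
set F := shear 1 _ in le_s.
have FE : F = F@_U_(s) *: 'X_s + (F@_0%MM)%:MP.
  apply/mpolyP => M; rewrite mcoeffD mcoeffZ mcoeffX mcoeffC.
  have [ltM|/le_last_var[] ->] := ltP U_(s)%MM M.
  - rewrite (lt_eqF ltM) (gt_eqF (le_lt_trans (le0x _) ltM)) !mulr0 addr0.
    exact/mcoeff_gt_mlead/(le_lt_trans le_s).
  - by rewrite mnm1_eq0 mulr0 add0r eqxx mulr1.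
  by rewrite eqxx mnm1_eq0 mulr1 mulr0 addr0.
apply/eqP/(pi_trivial_stabilizer (al := F@_U_(s)) (be := F@_0%MM)) => //.
rewrite -[LHS](shearK 1) -/F {1}FE raddfD /= linearZ /= unshearX.
congr (_ + _); exact: comp_mpolyC.
Qed.

End LeadsAfterShear.

(** * Closed semi-invariants *)

Section ClosedSemiinvariant.

Context {k : fieldType} {n N : nat} (G : {fset 'M[k]_n}) (chi : 'M[k]_n -> k).
Hypotheses (gG : finite_subgroup_GL G) (lin_chi : linear_character G chi).

Context (Phi : {lrmorphism {mpoly k[n]} -> {mpoly k[N]}}) (s : 'I_N).
Context (pi x : {mpoly k[n]}).
Hypotheses (injPhi : injective Phi) (nzpi : pi != 0) (nzx : x != 0).
Hypothesis lead_pi : mlead (Phi pi) = U_(s)%MM.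
Hypothesis lead_gpi : {in G, forall g, g != 1%:M ->
  (U_(s)%MM < mlead (Phi (mpoly_act g pi)))%O}.
Hypothesis lead_gx : {in G, forall g,
  mlead (Phi (mpoly_act g x)) != 0%MM /\ mlead (Phi (mpoly_act g x)) s = 0%N}.

(** Let p be the product of the g pi for g <> 1.  Since g p times g pi is the
    orbit product of pi, the leading monomial of Phi (g p) decreases as that of
    Phi (g pi) increases; hence the summand g = 1 leads in the twisted orbit
    sum of p.  Its exponent vector S need not be primitive.  The orbit product
    of pi contributes multiples of U_s + S and the orbit product of x
    contributes multiples of a vector V with V_s = 0 and V_i > 0 for some i;
    combining them, the coordinates s and i become coprime. *)
Lemma closed_semiinvariant_of_leads : exists h : {mpoly k[n]},
  closed_mpoly h /\ {in G, forall g, mpoly_act g h = chi g *: h}.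
Proof.
have [uG oneG _ _] := gG; have [nz_chi _] := lin_chi.
pose one : G := [` oneG]%fset.
have act_neq0 g f : g \in G -> f != 0 -> mpoly_act g f != 0.
  move=> gG'; apply: contraNneq => /(congr1 (mpoly_act (invmx g))).
  by rewrite mpoly_actK ?uG // rmorph0 => ->.
have Phi_neq0 f : f != 0 -> Phi f != 0.
  by apply: contraNneq => z; apply/eqP/injPhi; rewrite z rmorph0.
pose p := \prod_(g : G | g != one) mpoly_act (val g) pi.
pose Npi := \prod_(g : G) mpoly_act (val g) pi.
pose Nx := \prod_(g : G) mpoly_act (val g) x.
have NpiE : Npi = pi * p by rewrite /Npi (bigD1 one) //= mpoly_act1.
have invNpi g : g \in G -> mpoly_act g Npi = Npi.
  exact: (invariantsP _ _ (orbit_prod_invariant gG pi)).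
have invNx g : g \in G -> mpoly_act g Nx = Nx.
  exact: (invariantsP _ _ (orbit_prod_invariant gG x)).
have nzp : p != 0 by apply/prodf_neq0 => g _; apply: act_neq0 (valP g) nzpi.
have nzNpi : Npi != 0 by rewrite NpiE mulf_neq0.
have nzNx : Nx != 0 by apply/prodf_neq0 => g _; apply: act_neq0 (valP g) nzx.
set q := twisted_orbit_sum G chi p.
set S := mlead (Phi p).
have leadNpi : mlead (Phi Npi) = (U_(s) + S)%MM.
  by rewrite NpiE rmorphM /= mleadM ?Phi_neq0 // lead_pi.
have lead_gp g : g \in G ->
    (mlead (Phi (mpoly_act g pi)) + mlead (Phi (mpoly_act g p)) = U_(s) + S)%MM.
  move=> gG'; have prodE : Phi (mpoly_act g pi) * Phi (mpoly_act g p) = Phi Npi.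
    by rewrite -[in RHS](invNpi g gG') NpiE rmorphM rmorphM.
  by rewrite -leadNpi -prodE mleadM ?Phi_neq0 ?act_neq0.
have qE : Phi q = \sum_(g : G) (chi (val g))^-1 *: Phi (mpoly_act (val g) p).
  by rewrite /q /twisted_orbit_sum linear_sum; apply: eq_bigr => g _; rewrite /= linearZ.
have nz_inv (g : G) : (chi (val g))^-1 != 0 by rewrite invr_eq0 nz_chi ?(valP g).
have leadF g := mleadZ (Phi (mpoly_act (val g) p)) (nz_inv g).
have [lead_q leadc_q] : mlead (Phi q) = S /\ mleadc (Phi q) != 0.
  have [|lq lcq] := @mlead_sum_dominant k N _
      (fun g : G => (chi (val g))^-1 *: Phi (mpoly_act (val g) p)) one.
    move=> g ne _; rewrite (leadF g) (leadF one) [val one]/= mpoly_act1 -/S.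
    rewrite -(ltmc_add2r U_(s)%MM) -(lead_gp _ (valP g)) ltmc_add2l.
    exact: lead_gpi (valP g) ne.
  rewrite qE lcq lq mleadc_eq0 leadF; split; first by rewrite [val one]/= mpoly_act1.
  by rewrite scaler_eq0 negb_or nz_inv Phi_neq0 ?act_neq0.
have nzq : q != 0.
  by apply: contraNneq leadc_q => ->; rewrite rmorph0 mcoeff0.
have [V_neq0 V_s] : mlead (Phi Nx) != 0%MM /\ mlead (Phi Nx) s = 0%N.
  rewrite /Nx rmorph_prod mlead_prod => [|g _ _]; last first.
    exact/Phi_neq0/act_neq0/nzx/valP.
  split; last by rewrite mnm_sumE big1 // => g _; case: (lead_gx (valP g)).
  rewrite -mdeg_eq0 mdeg_sum sum_nat_eq0; apply/negP => /forallP /(_ one).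
  by rewrite implyTb mdeg_eq0; apply/negP; case: (lead_gx oneG).
have [i Vi] : exists i, (0 < mlead (Phi Nx) i)%N.
  apply/existsP; apply: contraNT V_neq0 => /existsPn V0.
  by apply/eqP/mnmP => i; apply/eqP; rewrite mnm0E -leqn0 leqNgt V0.
have [r [e co]] := exists_coprime_combination (S s) (S i) Vi.
exists (Nx ^+ r * Npi ^+ e * q); split; last first.
  move=> g gG'; rewrite rmorphM rmorphM !rmorphXn /= invNx // invNpi //.
  by rewrite (twisted_orbit_sum_semiinvariant gG lin_chi) // scalerAr.
apply: (closed_of_primitive_lead (Phi := Phi)).
apply: (@primitive_of_coprime _ _ s i).
have -> : mlead (Phi (Nx ^+ r * Npi ^+ e * q)) =
    (mlead (Phi Nx) *+ r + (U_(s) + S) *+ e + S)%MM.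
  rewrite rmorphM rmorphM !rmorphXn /= !mleadM ?mulf_neq0 ?expf_neq0 ?Phi_neq0 //.
  by rewrite !mleadX ?Phi_neq0 // leadNpi lead_q.
have ne_si : (s == i) = false.
  by apply/eqP => E; rewrite -E V_s in Vi.
rewrite !(mnmDE, mulmnE) V_s !mnm1E eqxx ne_si mul0n !add0n add1n.
by rewrite ![(_ * e)%N]mulnC [(_ * r)%N]mulnC.
Qed.

End ClosedSemiinvariant.

Lemma exists_closed_semiinvariant (k : fieldType) m (G : {fset 'M[k]_m.+2}) chi :
  finite_subgroup_GL G -> linear_character G chi ->
  exists h, closed_mpoly h /\ {in G, forall g, mpoly_act g h = chi g *: h}.
Proof.
move=> gG lin_chi; have [uG _ _ _] := gG.
have nzX i : 'X_i != 0 :> {mpoly k[m.+2]} by rewrite -msupp_eq0 msuppX.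
apply: (@closed_semiinvariant_of_leads _ _ _ _ _ gG lin_chi (shear 1) ord_max
  (sheared (fun i => 'X_i)) 'X_ord0).
- exact/can_inj/shearK.
- by apply: contraNneq (nzX ord_max) => z; rewrite -shear_pi z rmorph0.
- exact: nzX.
- by apply: etrans (congr1 (fun f => mlead f) shear_pi) _; rewrite mleadXm.
- by move=> g gG' ne; apply: mlead_shear_act_pi; rewrite ?uG.
move=> g gG'; apply: mlead_shear_linear (mpoly_actX g ord0) _.
apply: contraNneq (nzX ord0) => /(congr1 (mpoly_act (invmx g))).
by rewrite mpoly_actK ?uG // rmorph0 => ->.
Qed.

(** * The characterization of saturation *)

Section SaturatedTrivialCharacters.

Context {k : fieldType}.

Lemma closed_var n (i : 'I_n) : closed_mpoly ('X_i : {mpoly k[n]}).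
Proof.
apply: (@closed_of_primitive_lead _ _ _ idfun) => /= d l.
by rewrite mleadXm => /(_ i); rewrite mnm1E eqxx muln1.
Qed.

(** In one variable no shear is available, but the variable is a
    semi-invariant on which G acts faithfully. *)
Lemma trivial_characters_of_saturated n (G : {fset 'M[k]_n}) chi :
  finite_subgroup_GL G -> saturated (invariants G) ->
  linear_character G chi -> trivial_character G chi.
Proof.
case: n G chi => [|[|m]] G chi gG satG lin_chi g gG'.
- by rewrite [g]flatmx0 -[0](flatmx0 1%:M) (character1 gG lin_chi).
- suff -> : g = 1%:M by exact: character1 gG lin_chi.
  have actX g' : mpoly_act g' 'X_ord0 = invmx g' ord0 ord0 *: 'X_ord0 :> {mpoly k[1]}.
    by rewrite mpoly_actX big_ord1.
  have /(invariantsP _ _)/(_ g gG') : 'X_ord0 \in invariants G.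
    apply: (saturated_semiinvariant gG satG (closed_var ord0)) => g' _.
    exact: actX.
  rewrite actX => /(congr1 (mcoeff U_(ord0))).
  rewrite mcoeffZ mcoeffXU eqxx mulr1 => ig1.
  rewrite -[g]invmxK (_ : invmx g = 1%:M) ?invmx1 //.
  by apply/matrixP => i j; rewrite !ord1 ig1 mxE eqxx.
have [h [clh semih]] := exists_closed_semiinvariant gG lin_chi.
have := saturated_semiinvariant gG satG clh semih => /(invariantsP _ _)/(_ g gG').
rewrite semih // => /eqP; rewrite -subr_eq0 -{2}[h]scale1r -scalerBl scaler_eq0 subr_eq0.
case/orP=> [/eqP //|/eqP h0]; case: clh => [[]]; exists 0.
by rewrite h0 mpolyC0.
Qed.

End SaturatedTrivialCharacters.

Theorem theorem4 (k : fieldType) (n : nat) (G : {fset 'M[k]_n}) :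
  finite_subgroup_GL G ->
  saturated (invariants G) <->
  ~ (exists chi : 'M[k]_n -> k,
        linear_character G chi /\ ~ trivial_character G chi).
Proof.
move=> gG; split=> [satG [chi [lin_chi]]|]; last exact: saturated_of_trivial_characters.
by case; apply: trivial_characters_of_saturated.
Qed.
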